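(* Let $\eta,\sigma\in\{1,-1\}$, let $N\ge 0$ be an integer, let $\delta,\epsilon\in\mathbb{R}$ with $\epsilon\ne0$, let $\Gamma,T\in\mathbb{C}^{(2N+2)\times(2N+2)}$ be constant matrices satisfying $$\Gamma T+\sigma T\Gamma=0,\qquad T^2=\begin{cases}-\eta I,&\sigma=1,\\ \eta\,|e^{\Gamma}|^2 I,&\sigma=-1,\end{cases}$$ and let $C^{+}\in\mathbb{C}^{2N+2}$, $C^-=TC^+$. Let $$\Phi=e^{\Gamma n}\big[(4+\delta\epsilon\coth\Gamma)(4-\delta\epsilon\coth\Gamma)^{-1}\big]^{m/2}C^+,\qquad \Psi=e^{-\Gamma n}\big[(4+\delta\epsilon\coth\Gamma)(4-\delta\epsilon\coth\Gamma)^{-1}\big]^{-m/2}C^-,$$ and suppose that $\Psi=T\Phi_\sigma$. Define $$f=|e^{-N\Gamma}\Phi,\,e^{(-N+2)\Gamma}\Phi,\dots,e^{N\Gamma}\Phi;\ e^{N\Gamma}\Psi,\,e^{(N-2)\Gamma}\Psi,\dots,e^{-N\Gamma}\Psi|,$$ $$g=\tfrac1\epsilon|e^{-N\Gamma}\Phi,\,e^{(-N+2)\Gamma}\Phi,\dots,e^{(N+2)\Gamma}\Phi;\ e^{N\Gamma}\Psi,\,e^{(N-2)\Gamma}\Psi,\dots,e^{(-N+2)\Gamma}\Psi|,$$ and assume $f(n,m)\neq0$ for all $(n,m)\in\mathbb{Z}^2$. Then $$u=\frac gf,\qquad w=\frac{\widetilde f\,\widehat f}{f\,\widehat{\widetilde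 f}}$$ solve the real local ($\sigma=1$) and nonlocal ($\sigma=-1$) discrete sine-Gordon equation $$4\big(u+\widehat{\widetilde u}-(\widetilde u+\widehat u)w\big)=\delta\epsilon\big(u+\widehat{\widetilde u}+(\widetilde u+\widehat u)w\big),$$ $$(1+\eta\epsilon^2\,\widehat u\,\widehat u_\sigma)\,w=(1+\eta\epsilon^2\,u\,u_\sigma)\,\underline{w}$$ on $\mathbb{Z}^2$.
   Context: For a function $F=F(n,m)$ on $\mathbb{Z}^2$: $\widetilde F=F(n+1,m)$, $\widehat F=F(n,m+1)$, $\widehat{\widetilde F}=F(n+1,m+1)$, $\underline F=F(n-1,m)$, $F_\sigma=F(\sigma n,\sigma m)$, and $\widehat F_\sigma=F(\sigma n,\sigma m+\sigma)=F(\sigma n,\sigma(m+1))$. $|e^\Gamma|$ is the determinant of $e^\Gamma$; $|a_0,\dots,a_p;b_0,\dots,b_q|$ is the determinant of the matrix with the listed columns in this order (in $g$ there are $N+2$ columns built from $\Phi$ and $N$ columns built from $\Psi$, the latter block being empty if $N=0$). $\coth\Gamma=(e^{2\Gamma}+I)(e^{2\Gamma}-I)^{-1}$; it is assumed that $e^{2\Gamma}-I$ and $4I\pm\delta\epsilon\coth\Gamma$ are invertible. The power $[\cdot]^{m/2}$ means $S^m$, where $S$ is a fixed square root of $(4+\delta\epsilon\coth\Gamma)(4-\delta\epsilon\coth\Gamma)^{-1}$ that is a polynomial in $\Gamma$; the same $S$ is used in $\Phi$ and $\Psi$. *)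

(* Defs.v *)
From HB Require Import structures.
From mathcomp Require Import all_boot all_order all_algebra.
From mathcomp Require Import complex.
From mathcomp Require Import all_classical all_reals all_analysis.

Set Implicit Arguments.
Unset Strict Implicit.
Unset Printing Implicit Defensive.

Import Order.TTheory GRing.Theory Num.Theory.
Import numFieldNormedType.Exports.

Local Open Scope classical_set_scope.
Local Open Scope complex_scope.
Local Open Scope ring_scope.

Section MatrixFunctions.
(* An abstract K, used at K := R[i], carries the topology of its norm, which the
   library does not declare on the concrete type R[i]. *)
Variables (K : numFieldType) (n : nat).
Implicit Types A : 'M[K]_n.

Definition expmx A : 'M[K]_n :=
  limn (series (fun k : nat => (k`!%:R)^-1 *: A ^+ k)).

(* e^{k A} for an integer k *)
Definition expmxz A (k : int) : 'M[K]_n := expmx (k%:~R *: A).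

Definition cothmx A : 'M[K]_n :=
  (expmxz A 2 + 1%:M) *m invmx (expmxz A 2 - 1%:M).

End MatrixFunctions.

Section DoubleCasoratian.
Variables (R : realType) (N : nat).
Implicit Types (Gamma S : 'M[R[i]]_((2 * N).+2)) (C phi psi : 'cV[R[i]]_((2 * N).+2)).

(* In both Phi and Psi, S stands for a square root of
   (4 + delta epsilon coth Gamma) (4 - delta epsilon coth Gamma)^-1, so that
   S ^ m is the (m/2)-th power of the latter; S ^ m is the integer power in the
   unit ring of matrices, which is the genuine one as soon as S is invertible. *)
Definition Phi Gamma S C (n m : int) : 'cV[R[i]]_((2 * N).+2) :=
  expmxz Gamma n *m (S ^ m) *m C.

Definition Psi Gamma S C (n m : int) : 'cV[R[i]]_((2 * N).+2) :=
  expmxz Gamma (- n) *m (S ^ (- m)) *m C.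

(* The determinant with the p columns e^{(-N + 2 j) Gamma} phi, 0 <= j < p,
   followed by the 2 N + 2 - p columns e^{(N - 2 k) Gamma} psi, k = 0, 1, ... *)
Definition double_casoratian Gamma (p : nat) phi psi : R[i] :=
  \det (\matrix_(i < (2 * N).+2, j < (2 * N).+2)
    (if (j < p)%N
     then expmxz Gamma (- N%:Z + 2 * j%:Z) *m phi
     else expmxz Gamma (N%:Z - 2 * (j%:Z - p%:Z)) *m psi) i 0).

End DoubleCasoratian.

(* The two values of sigma select the local (1) and the nonlocal (-1) equation. *)
Definition solves_discrete_sine_gordon (R : realType) (eta sigma : int)
    (delta epsilon : R) (u w : int -> int -> R[i]) : Prop :=
  forall n m : int,
    4 * (u n m + u (n + 1) (m + 1) - (u (n + 1) m + u n (m + 1)) * w n m)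
      = (delta * epsilon)%:C
        * (u n m + u (n + 1) (m + 1) + (u (n + 1) m + u n (m + 1)) * w n m)
    /\ (1 + eta%:~R * (epsilon ^+ 2)%:C * u n (m + 1)
              * u (sigma * n) (sigma * (m + 1))) * w n m
      = (1 + eta%:~R * (epsilon ^+ 2)%:C * u n m
              * u (sigma * n) (sigma * m)) * w (n - 1) m.

(* Main.v *)
Require Import Defs.
From HB Require Import structures.
From mathcomp Require Import all_boot all_order all_algebra.
From mathcomp Require Import fingroup perm.
From mathcomp Require Import complex.
From mathcomp Require Import all_classical all_reals all_analysis.
From mathcomp Require Import ring zify.

(* With E = e^Gamma, f and eps g are determinants of columns E^k phi and E^k psi, which
   can be normalised by multiplying all the columns by a common matrix.  Put a = 4 - delta
   eps and b = 4 + delta eps: then S^2 (a E^2 - b) = b E^2 - a, so shifting m amounts, up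
   to a constant, to replacing phi by (b E^2 - a) phi and psi by (a E^2 - b) psi.  Both
   equations reduce to bilinear ones,
     a (g f^~ + g^~ f) = b (g~ f^ + g^ f~)   and   eps g h + f^2 = f~ f_,
   h being the determinant with N columns phi and N + 2 columns psi.  Each of them is an
   instance of the exchange relation sum_j (-1)^j |x_j, A| |X without x_j| = 0 for an
   n x (n - 1) matrix A and an n x (n + 1) matrix X: only the end columns of the two
   blocks of X contribute.  Finally, psi = T phi_sigma and the value of T^2 give
   eta eps^2 u u_sigma = eps g h / f^2, by a rotation of the columns if sigma = 1 and by
   their reversal if sigma = -1. *)

Set Implicit Arguments.
Unset Strict Implicit.
Unset Printing Implicit Defensive.

Import Order.TTheory GRing.Theory Num.Theory.
Import numFieldNormedType.Exports.

Local Open Scope complex_scope.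
Local Open Scope ring_scope.

(** * The exchange relation *)

Section Exchange.
Variable K : comNzRingType.

(** The determinant [|y, A|] as its Laplace expansion along [y]: linearity in [y] is then immediate,
    and [y] can be put at any column position up to a sign. *)
Definition insert_det n (A : 'M[K]_(n.+1, n)) (y : 'cV[K]_n.+1) : K :=
  \sum_i y i 0 * ((-1) ^+ i * \det (row' i A)).

Lemma det_insert n (B : 'M[K]_n.+1) (k : 'I_n.+1) :
  \det B = (-1) ^+ k * insert_det (col' k B) (col k B).
Proof.
rewrite (expand_det_col B k) mulr_sumr; apply: eq_bigr => i _.
by rewrite !mxE /cofactor exprD; ring.
Qed.

Lemma insert_det_col n (A : 'M[K]_(n.+1, n)) j : insert_det A (col j A) = 0.
Proof.
pose B : 'M[K]_(1 + n) := (row_mx (col j A) A : 'M[K]_(n.+1, 1 + n)).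
have colB : col 0 B = col j A.
  by apply/matrixP => i k; rewrite ord1 !mxE; case: splitP => [k' _|k' //]; rewrite mxE.
have col'B : col' 0 B = A.
  apply/matrixP => i k; rewrite !mxE; case: splitP => [k' /=|k' /=].
    by rewrite ord1.
  by rewrite /bump leq0n add1n => -[/val_inj ->].
have := det_insert B 0; rewrite colB col'B expr0 mul1r => <-.
rewrite -det_tr (@determinant_alternate _ _ _ 0 (rshift 1 j)) // => k.
have /matrixP/(_ k 0) := colB; rewrite [LHS]mxE [RHS]mxE => e.
by rewrite mxE e mxE -[LHS](row_mxEr (col j A)).
Qed.

Lemma insert_det_linear n (A : 'M[K]_(n.+1, n)) a b y z :
  insert_det A (a *: y - b *: z) = a * insert_det A y - b * insert_det A z.
Proof.
rewrite /insert_det !mulr_sumr -sumrB; apply: eq_bigr => i _.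
by rewrite !mxE; ring.
Qed.

(* The first row of [col_mx (L *m X) X] is a combination of the other ones. *)
Lemma det_exchange n (A : 'M[K]_(n.+1, n)) (X : 'M[K]_(n.+1, n.+2)) :
  \sum_(j < n.+2) (-1) ^+ j * insert_det A (col j X) * \det (col' j X) = 0.
Proof.
pose L : 'rV[K]_n.+1 := \row_i ((-1) ^+ i * \det (row' i A)).
pose Y : 'M[K]_(1 + n.+1) := (col_mx (L *m X) X : 'M[K]_(1 + n.+1, n.+2)).
have detY : \det Y = 0.
  (* The unipotent block matrix subtracts [L] times the lower rows from the first row, which becomes
     zero. *)
  have -> : \det Y = \det (block_mx 1%:M (- L) 0 1%:M *m Y).
    by rewrite det_mulmx det_ublock !det1 !mul1r.
  rewrite -[Y]vsubmxK; rewrite mul_block_col.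
  have -> : usubmx Y = L *m X by rewrite col_mxKu.
  have -> : dsubmx Y = X by rewrite col_mxKd.
  rewrite !mul1mx mul0mx add0r mulNmx subrr.
  rewrite (expand_det_row _ (0 : 'I_(1 + n.+1))) big1 // => j _.
  by rewrite mxE; case: splitP => [k _|//]; rewrite mxE mul0r.
rewrite -[RHS]detY (expand_det_row _ (0 : 'I_(1 + n.+1))); apply: eq_bigr => j _.
rewrite /cofactor add0n mulrCA -mulrA; congr (_ * (_ * _)).
  rewrite !mxE; case: splitP => [k _|//]; rewrite ord1 !mxE.
  by apply: eq_bigr => i _; rewrite !mxE mulrC.
congr (\det _); apply/matrixP => i k; rewrite !mxE.
case: splitP => [i' /=|i' /=]; first by rewrite ord1.
by rewrite /bump leq0n add1n => -[/val_inj ->].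
Qed.

End Exchange.
Lemma det_expn (R : comNzRingType) n (A : 'M[R]_n.+1) k :
  \det (A ^+ k) = \det A ^+ k.
Proof. by elim: k => [|k IHk]; rewrite ?det1 // !exprS detM IHk. Qed.

(** * Determinants given by their columns *)

Section Columns.
Variables (K : comNzRingType) (n : nat).
Implicit Types (c : nat -> 'cV[K]_n.+1).

Definition colsmx c : 'M[K]_n.+1 := \matrix_(i, j) c j i 0.

Lemma eq_colsmx c c' : (forall j, (j < n.+1)%N -> c j = c' j) -> colsmx c = colsmx c'.
Proof. by move=> ecc; apply/matrixP => i j; rewrite !mxE ecc. Qed.

Lemma mulmx_colsmx (Q : 'M[K]_n.+1) c : Q *m colsmx c = colsmx (fun j => Q *m c j).
Proof. by apply/matrixP => i j; rewrite !mxE; apply: eq_bigr => k _; rewrite mxE. Qed.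

Lemma det_colsmx_scale c p x : (p <= n.+1)%N ->
  \det (colsmx (fun j => if (j < p)%N then x *: c j else c j)) =
  x ^+ p * \det (colsmx c).
Proof.
move=> lepn.
pose d : 'rV[K]_n.+1 := \row_j (if (j < p)%N then x else 1).
have -> : colsmx (fun j => if (j < p)%N then x *: c j else c j) = colsmx c *m diag_mx d.
  apply/matrixP => i j; rewrite !mxE (bigD1 j) //= big1 ?addr0 => [|k kj].
    by rewrite !mxE eqxx mulr1n; case: ltnP; rewrite ?mxE ?mulr1 // mulrC.
  by rewrite !mxE (negPf kj) mulr0n mulr0.
rewrite det_mulmx det_diag mulrC; congr (_ * _).
under eq_bigr do rewrite mxE.
by rewrite -big_mkcond /= -(big_ord_widen _ (fun=> x)) // prodr_const card_ord.
Qed.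

(** As the number [n.+1] of columns is even, a cyclic shift by one place has sign -1: expanding
    along the last column on one side and along the first on the other gives the same minors. *)
Lemma det_colsmx_rot c k : odd n ->
  \det (colsmx (fun j => c ((j + k) %% n.+1)%N)) = (-1) ^+ k * \det (colsmx c).
Proof.
move=> oddn; elim: k => [|k IHk].
  rewrite expr0 mul1r; congr (\det _); apply: eq_colsmx => j jn.
  by rewrite addn0 modn_small.
rewrite exprS -mulrA -{}IHk (det_insert _ ord_max) (det_insert (colsmx _) 0) expr0 mul1r.
rewrite -signr_odd oddn expr1; congr (_ * insert_det _ _).
  apply/matrixP => i j; rewrite !mxE; congr (c _ i 0).
  by rewrite lift_max lift0 addnS.
apply/matrixP => i j; rewrite !mxE; congr (c _ i _).
by rewrite add0n /= addnS -addSn modnDl.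
Qed.

Definition rev_perm : 'S_n.+1 := perm (@rev_ord_inj n.+1).

Lemma det_colsmx_rev c :
  \det (colsmx (fun j => c (n - j)%N)) = (-1) ^+ rev_perm * \det (colsmx c).
Proof.
have -> : colsmx (fun j => c (n - j)%N) = col_perm rev_perm (colsmx c).
  by apply/matrixP => i j; rewrite !mxE permE.
by rewrite col_permE det_mulmx det_perm odd_permV mulrC.
Qed.

End Columns.

(** * Double Casoratians *)

Section Casoratian.
Variables (K : fieldType) (n : nat) (E : 'M[K]_n.+1).
Implicit Types (phi psi : 'cV[K]_n.+1) (s t : int) (p : nat).

(** [s] and [t] are the exponents of [E] at the first [phi]- and [psi]-columns. The number [k] of
    columns is free because the exchange relation also needs [n] and [n.+2] columns. *)
Definition casmx k p s t phi psi : 'M[K]_(n.+1, k) :=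
  \matrix_(i, j) (if (j < p)%N then E ^ (s + 2 * j%:Z) *m phi
                  else E ^ (t - 2 * (j%:Z - p%:Z)) *m psi) i 0.

Definition cas p s t phi psi : K := \det (casmx n.+1 p s t phi psi).

Lemma casE p s t phi psi : cas p s t phi psi =
  \det (colsmx (fun j => if (j < p)%N then E ^ (s + 2 * j%:Z) *m phi
                         else E ^ (t - 2 * (j%:Z - p%:Z)) *m psi)).
Proof. by []. Qed.

Lemma col_casmx k p s t phi psi (j : 'I_k) :
  col j (casmx k p s t phi psi) =
    if (j < p)%N then E ^ (s + 2 * j%:Z) *m phi
    else E ^ (t - 2 * (j%:Z - p%:Z)) *m psi.
Proof. by apply/matrixP => i z; rewrite ord1 !mxE. Qed.

Lemma col'_casmx k p s t p' s' t' (l : 'I_k.+1) phi psi :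
  (forall j : nat, (j < k)%N -> (bump l j < p)%N = (j < p')%N) ->
  (forall j : nat, (j < p')%N -> s + 2 * (bump l j)%:Z = s' + 2 * j%:Z) ->
  (forall j : nat, (p' <= j < k)%N ->
     t - 2 * ((bump l j)%:Z - p%:Z) = t' - 2 * (j%:Z - p'%:Z)) ->
  col' l (casmx k.+1 p s t phi psi) = casmx k p' s' t' phi psi.
Proof.
move=> hp hs ht; apply/matrixP => i j; rewrite !mxE /= hp //.
by case: ltnP => hj; rewrite ?hs ?ht ?hj /=.
Qed.

Lemma col'_casmx_first k p s t phi psi :
  col' 0 (casmx k.+1 p.+1 s t phi psi) = casmx k p (s + 2) t phi psi.
Proof. by apply: col'_casmx => j; rewrite /bump /=; lia. Qed.

Lemma col'_casmx_lastl k p s t (l : 'I_k.+1) phi psi : l = p :> nat ->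
  col' l (casmx k.+1 p.+1 s t phi psi) = casmx k p s t phi psi.
Proof. by move=> lp; apply: col'_casmx => j; rewrite /bump lp /=; lia. Qed.

Lemma col'_casmx_firstr k p s t (l : 'I_k.+1) phi psi : l = p :> nat ->
  col' l (casmx k.+1 p s t phi psi) = casmx k p s (t - 2) phi psi.
Proof. by move=> lp; apply: col'_casmx => j; rewrite /bump lp /=; lia. Qed.

Lemma col'_casmx_last k p s t phi psi : (p <= k)%N ->
  col' ord_max (casmx k.+1 p s t phi psi) = casmx k p s t phi psi.
Proof. by move=> lp; apply: col'_casmx => j; rewrite /bump /=; lia. Qed.

Section Inserted.
Variables (p : nat) (s t : int) (phi psi : 'cV[K]_n.+1).
Hypothesis lepn : (p <= n)%N.
Let A := casmx n p s t phi psi.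

(** Here and in the next three lemmas, the inserted vector prolongs one of the two progressions of
    [A] at one end; the sign moves it to its place. *)
Lemma insert_casmx_first :
  insert_det A (E ^ (s - 2) *m phi) = cas p.+1 (s - 2) t phi psi.
Proof.
rewrite /cas (det_insert _ 0) col'_casmx_first subrK col_casmx /=.
by rewrite mulr0 addr0 expr0 mul1r.
Qed.

Lemma insert_casmx_lastl :
  insert_det A (E ^ (s + 2 * p%:Z) *m phi) = (-1) ^+ p * cas p.+1 s t phi psi.
Proof.
pose l : 'I_n.+1 := Ordinal (lepn : (p < n.+1)%N).
rewrite /cas (det_insert _ l) col'_casmx_lastl // col_casmx /= ltnSn.
by rewrite mulrA -expr2 sqrr_sign mul1r.
Qed.

Lemma insert_casmx_firstr :
  insert_det A (E ^ (t + 2) *m psi) = (-1) ^+ p * cas p s (t + 2) phi psi.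
Proof.
pose l : 'I_n.+1 := Ordinal (lepn : (p < n.+1)%N).
rewrite /cas (det_insert _ l) col'_casmx_firstr // col_casmx /= ltnn addrK subrr.
by rewrite mulr0 subr0 mulrA -expr2 sqrr_sign mul1r.
Qed.

Lemma insert_casmx_last :
  insert_det A (E ^ (t - 2 * (n%:Z - p%:Z)) *m psi) = (-1) ^+ n * cas p s t phi psi.
Proof.
rewrite /cas (det_insert _ ord_max) col'_casmx_last // col_casmx /= ltnNge lepn.
by rewrite mulrA -expr2 sqrr_sign mul1r.
Qed.

Lemma insert_casmx_phi j : (j < p)%N ->
  insert_det A (E ^ (s + 2 * j%:Z) *m phi) = 0.
Proof.
move=> jp; have jn := leq_trans jp lepn.
by have := insert_det_col A (Ordinal jn); rewrite col_casmx /= jp.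
Qed.

Lemma insert_casmx_psi j : (p <= j < n)%N ->
  insert_det A (E ^ (t - 2 * (j%:Z - p%:Z)) *m psi) = 0.
Proof.
case/andP=> pj jn.
by have := insert_det_col A (Ordinal jn); rewrite col_casmx /= ltnNge pj.
Qed.

End Inserted.

Lemma sum_mul_eq k (F : 'I_k -> K) (l : 'I_k) c :
  \sum_(j < k) (c * (j == l :> nat)%:R) * F j = c * F l.
Proof.
rewrite (bigD1 l) //= eqxx mulr1 big1 ?addr0 // => j jl.
by rewrite -[(j == l :> nat)]/(j == l) (negPf jl) mulr0 mul0r.
Qed.

(** Exchange relation for [A] and [X]. A column of [X] combines [E ^ (z + 2)] and [E ^ z] applied to
    one vector, and inside a block both are columns of [A]. There remains one term for each end of
    each block: [j = 0], [p], [p.+1], [n.+1]. *)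
Lemma cas_bilinear_m p s t a b phi psi : E \in unitmx -> (p <= n)%N ->
  let phi' := b *: (E ^ 2 *m phi) - a *: phi in
  let psi' := a *: (E ^ 2 *m psi) - b *: psi in
  b * cas p.+1 s t phi psi * cas p (s - 2) t phi' psi'
  - a * cas p.+1 (s - 2) t phi psi * cas p s t phi' psi'
  - a * cas p s (t + 2) phi psi * cas p.+1 (s - 2) (t - 2) phi' psi'
  + b * cas p s t phi psi * cas p.+1 (s - 2) t phi' psi' = 0.
Proof.
move=> uE lepn phi' psi'.
pose A := casmx n p s t phi psi.
pose X := casmx n.+2 p.+1 (s - 2) t phi' psi'.
pose lp : 'I_n.+2 := Ordinal (leqW lepn : (p < n.+2)%N).
pose lp1 : 'I_n.+2 := Ordinal (lepn : (p.+1 < n.+2)%N).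
have insX (j : 'I_n.+2) : insert_det A (col j X) =
    b * ((-1) ^+ p * cas p.+1 s t phi psi) * (j == lp :> nat)%:R
    - a * cas p.+1 (s - 2) t phi psi * (j == 0%N :> nat)%:R
    + a * ((-1) ^+ p * cas p s (t + 2) phi psi) * (j == lp1 :> nat)%:R
    - b * ((-1) ^+ n * cas p s t phi psi) * (j == n.+1 :> nat)%:R.
  rewrite /X col_casmx ltnS.
  have ex z v : E ^ z *m (E ^ 2 *m v) = E ^ (z + 2) *m v.
    by rewrite mulmxA exprzDr.
  case: leqP => [jp|jp]; rewrite mulmxBr -!scalemxAr ex insert_det_linear.
    have -> : s - 2 + 2 * j%:Z + 2 = s + 2 * j%:Z by lia.
    have -> : (j == lp1 :> nat) = false by apply: negbTE; apply/eqP => /=; lia.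
    have -> : (j == n.+1 :> nat) = false by apply: negbTE; apply/eqP => /=; lia.
    rewrite !mulr0 addr0 subr0; congr (_ - _).
      rewrite -mulrA; congr (_ * _).
      case: (eqVneq (j : nat) p) => [->|jnp]; first by rewrite insert_casmx_lastl ?eqxx ?mulr1.
      rewrite insert_casmx_phi //=; last by lia.
      by rewrite mulr0.
    rewrite -mulrA; congr (_ * _).
    case: (posnP j) => [->|j0]; first by rewrite mulr0 addr0 insert_casmx_first ?mulr1.
    have -> : s - 2 + 2 * j%:Z = s + 2 * j.-1%:Z by lia.
    rewrite insert_casmx_phi //; last by lia.
    by rewrite mulr0.
  have -> : (j == lp :> nat) = false by apply: negbTE; apply/eqP => /=; lia.
  have -> : (j == 0%N :> nat) = false by apply: negbTE; apply/eqP => /=; lia.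
  rewrite !mulr0 subr0 add0r; congr (_ - _).
    rewrite -mulrA; congr (_ * _).
    case: (eqVneq (j : nat) p.+1) => [->|jnp].
      by rewrite subrr mulr0 subr0 insert_casmx_firstr ?eqxx ?mulr1.
    have -> : t - 2 * (j%:Z - p.+1%:Z) + 2 = t - 2 * (j.-2%:Z - p%:Z) by lia.
    rewrite insert_casmx_psi //=; last by have := ltn_ord j; lia.
    by rewrite mulr0.
  rewrite -mulrA; congr (_ * _).
  have -> : t - 2 * (j%:Z - p.+1%:Z) = t - 2 * (j.-1%:Z - p%:Z) by lia.
  case: (eqVneq (j : nat) n.+1) => [->|jnp].
    by rewrite insert_casmx_last ?eqxx ?mulr1.
  rewrite insert_casmx_psi //=; last by have := ltn_ord j; lia.
  by rewrite mulr0.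
have := det_exchange A X.
pose F (j : 'I_n.+2) := (-1) ^+ j * \det (col' j X).
under eq_bigr => j _ do rewrite mulrAC -/(F j) insX mulrC !(mulrDl, mulNr).
rewrite !(big_split, sumrN) /= (sum_mul_eq F lp) (sum_mul_eq F 0) (sum_mul_eq F lp1).
rewrite (sum_mul_eq F ord_max) /F /X col'_casmx_first subrK col'_casmx_lastl //.
rewrite col'_casmx_firstr // col'_casmx_last //= !exprS -/(cas _ _ _ _ _).
rewrite -!/(cas _ _ _ _ _) => <-; rewrite expr0.
(* The signs of position and of insertion agree up to a constant, so [(-1) ^+ p] and [(-1) ^+ n]
   occur only squared. *)
move: (sqrr_sign K p) (sqrr_sign K n); rewrite !expr2.
move: ((-1) ^+ p) ((-1) ^+ n) => x y hx hy.
by ring: hx hy.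
Qed.

(** Exchange relation with the same [phi] and [psi] in [A] and [X]. The [phi]-block of [X] sticks
    out of that of [A] only at its lower end, the [psi]-block at both ends, so three terms
    survive. *)
Lemma cas_bilinear_n p s t phi psi : E \in unitmx -> (p < n)%N ->
  cas p.+2 (s - 2) t phi psi * cas p s (t + 2) phi psi
  + cas p.+1 s (t + 2) phi psi * cas p.+1 (s - 2) t phi psi
  = cas p.+1 s t phi psi * cas p.+1 (s - 2) (t + 2) phi psi.
Proof.
move=> uE ltpn.
pose A := casmx n p.+1 s t phi psi.
pose X := casmx n.+2 p.+1 (s - 2) (t + 2) phi psi.
pose lp1 : 'I_n.+2 := Ordinal (leqW ltpn : (p.+1 < n.+2)%N).
have insX (j : 'I_n.+2) : insert_det A (col j X) =
    cas p.+2 (s - 2) t phi psi * (j == 0%N :> nat)%:R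
    + (-1) ^+ p.+1 * cas p.+1 s (t + 2) phi psi * (j == lp1 :> nat)%:R
    + (-1) ^+ n * cas p.+1 s t phi psi * (j == n.+1 :> nat)%:R.
  rewrite /X col_casmx ltnS; case: leqP => [jp|jp].
    have -> : (j == lp1 :> nat) = false by apply: negbTE; apply/eqP => /=; lia.
    have -> : (j == n.+1 :> nat) = false by apply: negbTE; apply/eqP => /=; lia.
    rewrite !mulr0 !addr0.
    case: (posnP j) => [->|j0]; first by rewrite mulr0 addr0 insert_casmx_first ?mulr1.
    have -> : s - 2 + 2 * j%:Z = s + 2 * j.-1%:Z by lia.
    by rewrite insert_casmx_phi ?mulr0 //; lia.
  have -> : (j == 0%N :> nat) = false by apply: negbTE; apply/eqP => /=; lia.
  rewrite mulr0 add0r.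
  case: (eqVneq (j : nat) p.+1) => [->|jnp].
    have -> : (p.+1 == n.+1) = false by apply: negbTE; apply/eqP => /=; lia.
    by rewrite subrr mulr0 subr0 insert_casmx_firstr ?eqxx ?mulr1 ?mulr0 ?addr0.
  have -> : t + 2 - 2 * (j%:Z - p.+1%:Z) = t - 2 * (j.-1%:Z - p.+1%:Z) by lia.
  rewrite /= mulr0 add0r.
  case: (eqVneq (j : nat) n.+1) => [->|jnn].
    by rewrite insert_casmx_last ?eqxx ?mulr1.
  by rewrite insert_casmx_psi ?mulr0 //; have := ltn_ord j; lia.
have := det_exchange A X.
pose F (j : 'I_n.+2) := (-1) ^+ j * \det (col' j X).
under eq_bigr => j _ do rewrite mulrAC -/(F j) insX mulrC !(mulrDl, mulNr).
rewrite !(big_split, sumrN) /= (sum_mul_eq F 0) (sum_mul_eq F lp1).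
rewrite (sum_mul_eq F ord_max) /F /X col'_casmx_first subrK.
rewrite col'_casmx_firstr // col'_casmx_last 1?ltnW //= addrK.
rewrite -!/(cas _ _ _ _ _) expr0 !exprS.
move: (sqrr_sign K p) (sqrr_sign K n); rewrite !expr2.
move: ((-1) ^+ p) ((-1) ^+ n) => x y hx hy.
move=> e; apply/eqP; rewrite -subr_eq0; apply/eqP; rewrite -{}e.
by ring: hx hy.
Qed.

Hypothesis uE : E \in unitmx.

Lemma cas_expz p s t k l phi psi :
  cas p s t (E ^ k *m phi) (E ^ l *m psi) = cas p (s + k) (t + l) phi psi.
Proof.
rewrite !casE; congr (\det _); apply: eq_colsmx => j _.
have ex z y v : E ^ z *m (E ^ y *m v) = E ^ (z + y) *m v.
  by rewrite mulmxA exprzDr.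
by rewrite !ex; case: ltnP => _; congr (E ^ _ *m _); lia.
Qed.

Lemma cas_mulmx p s t Q phi psi : GRing.comm Q E ->
  cas p s t (Q *m phi) (Q *m psi) = \det Q * cas p s t phi psi.
Proof.
move=> cQE; rewrite !casE -det_mulmx mulmx_colsmx; congr (\det _).
have ex z v : E ^ z *m (Q *m v) = Q *m (E ^ z *m v).
  by rewrite !mulmxA; congr (_ *m _); apply/esym/commrXz.
by apply: eq_colsmx => j _; rewrite !ex; case: ltnP.
Qed.

(** Up to a power of [\det E], only the difference [t - s] matters. *)
Lemma cas_shift p s t (k : nat) phi psi :
  cas p (s + k%:Z) (t + k%:Z) phi psi = \det E ^+ k * cas p s t phi psi.
Proof.
by rewrite -cas_expz cas_mulmx ?det_expn //; apply/commr_sym/commrX.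
Qed.

Section Swap.
Variables (T : 'M[K]_n.+1) (tau : K).

(** [T] negates all exponents, so the increasing block turns into a decreasing one and conversely. A
    rotation by [n.+1 - p] columns restores the order of the blocks; as [n.+1] is even, its sign is
    [(-1) ^+ p], absorbed in [- tau]. *)
Lemma cas_swap_anticomm p s t phi psi : odd n -> (p <= n.+1)%N ->
  (forall z : int, E ^ z *m T = T *m E ^ (- z)) ->
  cas p s t (tau *: (T *m psi)) (T *m phi) =
  \det T * (- tau) ^+ p * cas (n.+1 - p) (- t) (- s) phi psi.
Proof.
move=> oddn lepn ET.
pose c j := if (j < n.+1 - p)%N then E ^ (- t + 2 * j%:Z) *m phi
            else E ^ (- s - 2 * (j%:Z - (n.+1 - p)%:Z)) *m psi.
rewrite exprNn [in LHS]casE.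
transitivity (\det (T *m colsmx (fun j => if (j < p)%N
     then tau *: c ((j + (n.+1 - p)) %% n.+1)%N else c ((j + (n.+1 - p)) %% n.+1)%N))).
  rewrite mulmx_colsmx; congr (\det _); apply: eq_colsmx => j jn; rewrite /c.
  case: ltnP => jp; rewrite -?scalemxAr !mulmxA ET.
    rewrite modn_small; last by lia.
    rewrite ltnNge leq_addl /= mulmxA; congr (_ *: (_ *m E ^ _ *m _)); lia.
  have -> : (j + (n.+1 - p) = (j - p) + n.+1)%N by lia.
  rewrite modnDr modn_small; last by lia.
  case: ltnP => h; last by lia.
  by rewrite mulmxA; congr (_ *m E ^ _ *m _); lia.
rewrite det_mulmx -!mulrA; congr (_ * _).
rewrite (det_colsmx_scale (fun j => c ((j + (n.+1 - p)) %% n.+1)%N)) //.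
rewrite det_colsmx_rot // mulrCA; congr (_ * (_ * _)).
by rewrite -signr_odd oddB //= oddn /= signr_odd.
Qed.

(** [T] keeps the exponents, so after the swap each block runs the wrong way. Reversing all the
    columns corrects this and the order of the blocks at once; the new starting exponents are the
    old final ones. *)
Lemma cas_swap_comm p s t phi psi : (p <= n.+1)%N ->
  (forall z : int, E ^ z *m T = T *m E ^ z) ->
  cas p s t (tau *: (T *m psi)) (T *m phi) =
  \det T * (-1) ^+ rev_perm n * tau ^+ p *
  cas (n.+1 - p) (t - 2 * (n%:Z - p%:Z)) (s + 2 * p%:Z - 2) phi psi.
Proof.
move=> lepn ET.
pose c j := if (j < n.+1 - p)%N then E ^ (t - 2 * (n%:Z - p%:Z) + 2 * j%:Z) *m phi
            else E ^ (s + 2 * p%:Z - 2 - 2 * (j%:Z - (n.+1 - p)%:Z)) *m psi.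
rewrite [in LHS]casE.
transitivity (\det (T *m colsmx (fun j => if (j < p)%N
     then tau *: c (n - j)%N else c (n - j)%N))).
  rewrite mulmx_colsmx; congr (\det _); apply: eq_colsmx => j jn; rewrite /c.
  case: ltnP => jp; rewrite -?scalemxAr !mulmxA ET.
    case: ltnP => h; first by lia.
    by rewrite mulmxA; congr (_ *: (_ *m E ^ _ *m _)); lia.
  case: ltnP => h; last by lia.
  by rewrite mulmxA; congr (_ *m E ^ _ *m _); lia.
rewrite det_mulmx -!mulrA; congr (_ * _).
by rewrite (det_colsmx_scale (fun j => c (n - j)%N)) // det_colsmx_rev mulrCA.
Qed.

End Swap.

End Casoratian.

(** * The functions f, eps g and h on the lattice *)

Section Soliton.
Variables (K : fieldType) (N : nat) (E S : 'M[K]_((2 * N).+2)).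
Variables Cp Cm : 'cV[K]_((2 * N).+2).
Hypothesis uE : E \in unitmx.

Definition phi (k l : int) := E ^ k *m S ^ l *m Cp.
Definition psi (k l : int) := E ^ (- k) *m S ^ (- l) *m Cm.

(** A step in n multiplies [phi] and [psi] by inverse powers of [E], hence moves the starting
    exponents in opposite directions. With [cas_shift], a unit step amounts to moving one of them by
    2. *)
Lemma cas_stepn p s t k k' l :
  cas E p s t (phi (k + k') l) (psi (k + k') l) =
  cas E p (s + k') (t - k') (phi k l) (psi k l).
Proof.
have EX z y (v : 'cV_((2 * N).+2)) X :
    E ^ (z + y) *m X *m v = E ^ y *m (E ^ z *m X *m v).
  by rewrite !mulmxA addrC exprzDr.
by rewrite -cas_expz // /phi /psi opprD !EX.
Qed.

(** The values [N.+1], [N.+2] and [N] of [p] give f, eps g and h. *)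
Definition soliton_cas p k l := cas E p (- N%:Z) N%:Z (phi k l) (psi k l).

Lemma soliton_cas_bilinear_n k l :
  soliton_cas N.+2 k l * soliton_cas N k l + soliton_cas N.+1 k l ^+ 2 =
  soliton_cas N.+1 (k + 1) l * soliton_cas N.+1 (k - 1) l.
Proof.
have dE0 : \det E != 0 by rewrite -unitfE -unitmxE.
have lt : (N < (2 * N).+1)%N by lia.
(* For these starting exponents each of the three products is that of the claim times
   [\det E ^+ 2]. *)
have := cas_bilinear_n (2 - N%:Z) N%:Z (phi k l) (psi k l) uE lt.
have -> : 2 - N%:Z - 2 = - N%:Z by lia.
have -> : cas E N (2 - N%:Z) (N%:Z + 2) (phi k l) (psi k l) = \det E ^+ 2 * soliton_cas N k l.
  by rewrite /soliton_cas -cas_shift //; congr cas; lia.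
have -> : cas E N.+1 (2 - N%:Z) (N%:Z + 2) (phi k l) (psi k l) = \det E ^+ 2 * soliton_cas N.+1 k l.
  by rewrite /soliton_cas -cas_shift //; congr cas; lia.
have -> : cas E N.+1 (2 - N%:Z) N (phi k l) (psi k l) = \det E * soliton_cas N.+1 (k + 1) l.
  by rewrite /soliton_cas cas_stepn -[in RHS](expr1 (\det E)) -cas_shift //; congr cas; lia.
have -> : cas E N.+1 (- N%:Z) (N%:Z + 2) (phi k l) (psi k l) = \det E * soliton_cas N.+1 (k - 1) l.
  by rewrite /soliton_cas cas_stepn -[in RHS](expr1 (\det E)) -cas_shift //; congr cas; lia.
rewrite -!/(soliton_cas _ _ _) => e; apply: (mulfI (expf_neq0 2 dE0)).
apply/eqP; rewrite -subr_eq0; apply/eqP.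
by move/eqP: e; rewrite -subr_eq0 => /eqP <-; ring.
Qed.

(** * The reflection by sigma *)

Section Reflection.
Variables (T : 'M[K]_((2 * N).+2)) (x : K).
Hypotheses (T2 : T *m T = x%:M) (x0 : x != 0).

Let phi_inv k l k' l' : psi k l = T *m phi k' l' -> phi k' l' = x^-1 *: (T *m psi k l).
Proof.
by move=> ->; rewrite mulmxA T2 mul_scalar_mx scalerA mulVf // scale1r.
Qed.

(** As the square of [T] is the scalar [x], [psi = T phi] also gives [phi = x^-1 T psi]: the pair is
    its own swap. *)
Lemma soliton_cas_reflect_local p k l : (p <= (2 * N).+2)%N ->
  (forall z : int, E ^ z *m T = T *m E ^ (- z)) ->
  psi k l = T *m phi k l ->
  soliton_cas p k l = \det T * (- x^-1) ^+ p * soliton_cas ((2 * N).+2 - p) k l.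
Proof.
move=> lep ET psiE; transitivity (cas E p (- N%:Z) N (x^-1 *: (T *m psi k l)) (T *m phi k l)).
  by rewrite -(phi_inv psiE) -psiE.
rewrite cas_swap_anticomm //; first by rewrite opprK.
by rewrite mul2n /= odd_double.
Qed.

(** The vectors at [(- k, - l)] are the swap of those at [(k, l)]. The new starting exponents are
    [- N] and [N] if [p = N.+1]; both are larger by 2 if [p = N.+2]. *)
Lemma soliton_cas_reflect_nonlocal p k l : (p <= (2 * N).+2)%N ->
  (forall z : int, E ^ z *m T = T *m E ^ z) ->
  (forall k l, psi k l = T *m phi (- k) (- l)) ->
  soliton_cas p (- k) (- l) = \det T * (-1) ^+ rev_perm (2 * N).+1 * x^-1 ^+ p *
    cas E ((2 * N).+2 - p) (2 * p%:Z - 3 * N%:Z - 2) (2 * p%:Z - N%:Z - 2)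
      (phi k l) (psi k l).
Proof.
move=> lep ET psiE; transitivity (cas E p (- N%:Z) N (x^-1 *: (T *m psi k l)) (T *m phi k l)).
  by rewrite -(phi_inv (psiE k l)) /soliton_cas psiE !opprK.
rewrite cas_swap_comm //.
by congr (_ * cas _ _ _ _ _ _); lia.
Qed.

End Reflection.

(* The constant c, which is not needed explicitly, drops out of u_sigma = g_sigma / f_sigma. *)
Lemma soliton_cas_reflect (T : 'M[K]_((2 * N).+2)) (eta : K) (sigma : int) :
  eta ^+ 2 = 1 ->
  sigma = 1 /\ T *m T = (- eta)%:M \/
  sigma = -1 /\ T *m T = (eta * \det E ^+ 2)%:M ->
  (forall z : int, E ^ z *m T = T *m E ^ (- sigma * z)) ->
  (forall k l, psi k l = T *m phi (sigma * k) (sigma * l)) ->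
  exists c, forall k l,
    soliton_cas N.+1 (sigma * k) (sigma * l) = c * soliton_cas N.+1 k l /\
    eta * soliton_cas N.+2 (sigma * k) (sigma * l) = c * soliton_cas N k l.
Proof.
move=> eta2 hsigma ET psiE.
have dE0 : \det E != 0 by rewrite -unitfE -unitmxE.
have eta0 : eta != 0.
  by apply: contra_eq_neq eta2 => ->; rewrite expr0n eq_sym oner_eq0.
have etaV : eta^-1 = eta by apply: (mulfI eta0); rewrite mulfV // -expr2 eta2.
have e1 : ((2 * N).+2 - N.+1 = N.+1)%N by lia.
have e2 : ((2 * N).+2 - N.+2 = N)%N by lia.
case: hsigma => -[sE T2]; move: ET psiE; rewrite sE => ET psiE.
  (* Here [- x^-1 = eta]; passing from [p = N.+1] to [N.+2] brings one more [eta], which cancels the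
     one in the claim. *)
  exists (\det T * eta ^+ N.+1) => k l; rewrite !mul1r.
  have x0 : - eta != 0 by rewrite oppr_eq0.
  have ET' z : E ^ z *m T = T *m E ^ (- z) by rewrite ET mulN1r.
  have psiE' : psi k l = T *m phi k l by rewrite psiE !mul1r.
  have r p lep := @soliton_cas_reflect_local _ _ T2 x0 p k l lep ET' psiE'.
  rewrite [in LHS]r ?[soliton_cas N.+2 _ _]r ?e1 ?e2; [|lia..].
  rewrite invrN opprK etaV; split=> //.
  by rewrite [eta ^+ N.+2]exprS; rewrite -[RHS]mul1r -eta2; ring.
have x0 : eta * \det E ^+ 2 != 0 by rewrite mulf_neq0 ?expf_neq0.
have ET' z : E ^ z *m T = T *m E ^ z by rewrite ET opprK mul1r.
have psiE' k l : psi k l = T *m phi (- k) (- l) by rewrite psiE !mulN1r.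
exists (\det T * (-1) ^+ rev_perm (2 * N).+1 * (eta * \det E ^+ 2)^-1 ^+ N.+1) => k l.
rewrite !mulN1r.
have r p lep := @soliton_cas_reflect_nonlocal _ _ T2 x0 p k l lep ET' psiE'.
rewrite !r ?e1 ?e2; [|lia..].
split; first by congr (_ * cas _ _ _ _ _ _); lia.
have -> : cas E N (2 * N.+2%:Z - 3 * N%:Z - 2) (2 * N.+2%:Z - N%:Z - 2) (phi k l) (psi k l)
   = \det E ^+ 2 * soliton_cas N k l by rewrite /soliton_cas -cas_shift //; congr cas; lia.
rewrite [_^-1 ^+ N.+2]exprS.
(* The factor [\det E ^+ 2] in the square of [T] compensates the shift of exponents just found. *)
have : eta * (eta * \det E ^+ 2)^-1 * \det E ^+ 2 = 1 by field; rewrite eta0 dE0.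
move: (eta * \det E ^+ 2)^-1 => y.
move: (soliton_cas N k l) (y ^+ N.+1) (\det E) ((-1) ^+ _) => X1 X2 X3 X4 e.
by rewrite -[RHS]mul1r -e; ring.
Qed.

(** * The step in m *)

Section TimeStep.
Variables a b : K.
Let D := a *: E ^ 2 - b%:M.
Let B := b *: E ^ 2 - a%:M.
Hypotheses (uS : S \in unitmx) (cSE : GRing.comm S E)
  (uD : D \in unitmx) (SSD : S * S * D = B).

Let commD X : GRing.comm X E -> GRing.comm X D.
Proof.
move=> cXE; apply: commrB; last exact: comm_mx_scalar.
by rewrite -mul_scalar_mx; apply: commrM; [exact: comm_mx_scalar | exact: commrXz].
Qed.

(** All columns at [l + 1] are multiplied by [S * D]. The new [phi] carries an extra [S], which
    makes [S * S * D = B]; the new [psi] carries an extra inverse of [S], which leaves [D]. *)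
Lemma cas_stepm p s t k l :
  \det (S * D) * cas E p s t (phi k (l + 1)) (psi k (l + 1)) =
  cas E p s t (b *: (E ^ 2 *m phi k l) - a *: phi k l)
              (a *: (E ^ 2 *m psi k l) - b *: psi k l).
Proof.
have cSD : S * D = D * S by apply: commD.
have cDE : GRing.comm D E by apply/commr_sym/commD.
have cSE' z : S * E ^ z = E ^ z * S by apply: commrXz.
have cDE' z : D * E ^ z = E ^ z * D by apply: commrXz.
have cDS z : D * S ^ z = S ^ z * D by apply: commrXz.
rewrite -cas_mulmx //; last by apply/commr_sym/commrM; apply: commr_sym.
congr (cas _ _ _ _ _ _).
  rewrite scalemxAl -(mul_scalar_mx a) -mulmxBl -/B -SSD /phi !mulmxA; congr (_ *m _).
  rewrite !mulmxE exprzDr // expr1z -!mulrA; congr (_ * _).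
  rewrite [RHS]mulrA cSD -mulrA; congr (_ * _).
  rewrite [RHS]mulrA cSE' -mulrA; congr (_ * _).
  exact/commr_sym/commrXz.
rewrite scalemxAl -(mul_scalar_mx b) -mulmxBl -/D /psi !mulmxA; congr (_ *m _).
rewrite !mulmxE cSD -!mulrA; congr (_ * _).
rewrite [LHS]mulrA cSE' -mulrA; congr (_ * _).
by rewrite -[in LHS](expr1z S) -exprzDr //; congr (S ^ _); lia.
Qed.

Lemma soliton_cas_bilinear_m k l :
  a * (soliton_cas N.+2 k l * soliton_cas N.+1 (k + 1) (l + 1)
       + soliton_cas N.+2 (k + 1) (l + 1) * soliton_cas N.+1 k l) =
  b * (soliton_cas N.+2 (k + 1) l * soliton_cas N.+1 k (l + 1)
       + soliton_cas N.+2 k (l + 1) * soliton_cas N.+1 (k + 1) l).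
Proof.
have dE0 : \det E != 0 by rewrite -unitfE -unitmxE.
have dSD0 : \det (S * D) != 0 by rewrite -unitfE -unitmxE unitmx_mul uS.
have le : (N.+1 <= (2 * N).+1)%N by lia.
(* Each of the four products will be that of the claim times [\det (S * D) * \det E]. *)
have := cas_bilinear_m (2 - N%:Z) N%:Z a b (phi k l) (psi k l) uE le.
rewrite /= -!cas_stepm.
have e3 : 2 - N%:Z - 2 = - N%:Z by lia.
rewrite e3.
have -> : cas E N.+2 (2 - N%:Z) N (phi k l) (psi k l) = \det E * soliton_cas N.+2 (k + 1) l.
  by rewrite /soliton_cas cas_stepn -[in RHS](expr1 (\det E)) -cas_shift //; congr cas; lia.
have -> : cas E N.+1 (2 - N%:Z) N (phi k (l + 1)) (psi k (l + 1)) =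
    \det E * soliton_cas N.+1 (k + 1) (l + 1).
  by rewrite /soliton_cas cas_stepn -[in RHS](expr1 (\det E)) -cas_shift //; congr cas; lia.
have -> : cas E N.+1 (2 - N%:Z) N (phi k l) (psi k l) = \det E * soliton_cas N.+1 (k + 1) l.
  by rewrite /soliton_cas cas_stepn -[in RHS](expr1 (\det E)) -cas_shift //; congr cas; lia.
have -> : cas E N.+1 (2 - N%:Z) (N%:Z + 2) (phi k l) (psi k l) = \det E ^+ 2 * soliton_cas N.+1 k l.
  by rewrite /soliton_cas -cas_shift //; congr cas; lia.
have h : soliton_cas N.+2 (k + 1) (l + 1) =
    \det E * cas E N.+2 (- N%:Z) (N%:Z - 2) (phi k (l + 1)) (psi k (l + 1)).
  by rewrite /soliton_cas cas_stepn -[in RHS](expr1 (\det E)) -cas_shift //; congr cas; lia.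
move: h; rewrite -!/(soliton_cas _ _ _); set Y := cas _ _ _ _ _ _ => ->.
move=> e; apply: (mulfI dE0); apply: (mulfI dSD0); apply/eqP; rewrite -subr_eq0; apply/eqP.
rewrite -[RHS]oppr0 -{}e; ring.
Qed.

End TimeStep.

End Soliton.

(** * The matrix exponential *)

Section ExpSum.
Variables (F : numFieldType) (L : algType F).
Implicit Types x y : L.

(** Taken in any algebra, so that [expsumD] serves both for matrices and for the real numbers
    bounding their entries. *)
Definition expsum k x : L := \sum_(0 <= i < k) (i`!%:R : F)^-1 *: x ^+ i.

Lemma sum_triangle (f : nat -> nat -> L) k :
  \sum_(0 <= m < k) \sum_(0 <= i < m.+1) f i (m - i)%N =
  \sum_(0 <= i < k) \sum_(0 <= j < k - i) f i j.
Proof.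
elim: k => [|k IHk]; first by rewrite !big_geq.
rewrite big_nat_recr //= {}IHk [RHS]big_nat_recr //= subSnn big_nat1.
rewrite [X in _ + X]big_nat_recr //= subnn addrA -big_split /=; congr (_ + _).
apply: eq_big_nat => i /andP[_ ik].
by rewrite subSn ?(ltnW ik) // big_nat_recr.
Qed.

(** By the binomial formula the terms of the product with [i + j < k] add up to the partial sum of
    [x + y]; those with [i + j >= k] are left. *)
Lemma expsumD k x y : GRing.comm x y ->
  expsum k x * expsum k y - expsum k (x + y) =
  \sum_(0 <= i < k) \sum_(k - i <= j < k)
     ((i`!%:R : F)^-1 * (j`!%:R)^-1) *: (x ^+ i * y ^+ j).
Proof.
move=> cxy.
pose f i j := ((i`!%:R : F)^-1 * (j`!%:R)^-1) *: (x ^+ i * y ^+ j).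
have -> : expsum k (x + y) = \sum_(0 <= i < k) \sum_(0 <= j < k - i) f i j.
  rewrite -sum_triangle; apply: eq_big_nat => m _.
  rewrite addrC exprDn_comm; last exact: commr_sym.
  rewrite scaler_sumr big_mkord; apply: eq_bigr => i _.
  have im : (i <= m)%N by rewrite -ltnS.
  rewrite /f (commrX _ (commr_sym (commrX _ (commr_sym cxy)))).
  rewrite -(scaler_nat 'C(m, i)) scalerA; congr (_ *: _).
  have nz (l : nat) : l`!%:R != 0 :> F by rewrite pnatr_eq0 -lt0n fact_gt0.
  have /(congr1 (fun l => l%:R : F)) := bin_fact im; rewrite !natrM => <-.
  have bnz : 'C(m, i)%:R != 0 :> F by rewrite pnatr_eq0 -lt0n bin_gt0.
  by field; rewrite !nz bnz.
rewrite /expsum big_distrl /= -sumrB; apply: eq_big_nat => i /andP[_ ik].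
rewrite big_distrr /= (@big_cat_nat _ _ _ (k - i)) ?leq_subr //=.
rewrite addrAC [X in X + _](_ : _ = 0) ?add0r.
  by apply: eq_bigr => j _; rewrite -scalerAl -scalerAr scalerA.
apply/eqP; rewrite subr_eq0; apply/eqP; apply: eq_bigr => j _.
by rewrite -scalerAl -scalerAr scalerA.
Qed.

End ExpSum.

(** * Entrywise limits and bounds on matrix powers *)

Section MatrixLimits.
Local Open Scope classical_set_scope.
Variable K : numFieldType.

Lemma cvg_epsP (u : nat -> K) (l : K) : u @ \oo --> l <->
  forall e, 0 < e -> exists k0 : nat, forall k, (k0 <= k)%N -> `|l - u k| < e.
Proof.
split=> [/cvgrPdist_lt ul e e0|ul].
  by have [k0 _ uk0] := ul e e0; exists k0 => k /uk0.
by apply/cvgrPdist_lt => e /ul[k0 uk0]; exists k0 => // k /uk0.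
Qed.

(** Limits are handled entry by entry, hence as scalar ones; [cvgmx_lim] leads back to the [limn] of
    [expmx]. *)
Definition cvgmx m n (u : nat -> 'M[K]_(m, n)) (l : 'M[K]_(m, n)) :=
  forall i j, (fun k => u k i j) @ \oo --> l i j.

Lemma cvgmx_lim n (u : nat -> 'M[K]_n.+1) l : cvgmx u l -> limn u = l.
Proof.
move=> ul; apply: cvg_lim; first exact: norm_hausdorff.
move=> A [P lP PA]; have : \forall k \near \oo, forall i j, P i j (u k i j).
  by apply: filter_forall => i; apply: filter_forall => j; apply: ul; apply: lP.
by apply: filterS => k uk; apply: PA.
Qed.

Lemma cvgmx_unique m n (u : nat -> 'M[K]_(m, n)) l l' :
  cvgmx u l -> cvgmx u l' -> l = l'.
Proof.
move=> ul ul'; apply/matrixP => i j.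
by apply: (cvg_unique _ (ul i j) (ul' i j)); exact: norm_hausdorff.
Qed.

Lemma cvgmx_mulmx m n p (u : nat -> 'M[K]_(m, n)) (v : nat -> 'M[K]_(n, p)) l l' :
  cvgmx u l -> cvgmx v l' -> cvgmx (fun k => u k *m v k) (l *m l').
Proof.
move=> ul vl i j; rewrite mxE.
under eq_fun do rewrite mxE.
apply: cvg_big => [|k _]; first exact: add_continuous.
by apply: cvgM; [exact: ul | exact: vl].
Qed.

Lemma cvgmx_cst m n (l : 'M[K]_(m, n)) : cvgmx (fun=> l) l.
Proof. by move=> i j; apply: cvg_cst. Qed.

Definition mxnorm1 n (A : 'M[K]_n) : K := \sum_i \sum_j `|A i j|.

(** Induction on [k]: each row of [A] has absolute sum at most [mxnorm1 A]. *)
Lemma normr_mulmx_pow n (A C : 'M[K]_n.+1) k b :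
  (forall i j, `|C i j| <= b) ->
  forall i j, `|(A ^+ k * C) i j| <= mxnorm1 A ^+ k * b.
Proof.
move=> Cb; have b0 : 0 <= b by apply: le_trans (Cb 0 0).
have n0 (B : 'M[K]_n.+1) (P : pred 'I_n.+1) : 0 <= \sum_(i | P i) \sum_j `|B i j|.
  by apply: sumr_ge0 => i _; apply: sumr_ge0.
elim: k => [|k IHk] i j; first by rewrite !expr0 !mul1r.
rewrite exprS -mulrA mxE (le_trans (ler_norm_sum _ _ _)) //.
rewrite exprS -mulrA {1}/mxnorm1 mulr_suml [leRHS](bigD1 i) //=.
apply: ler_wpDr; first by rewrite -mulr_suml mulr_ge0 ?n0 // mulr_ge0 // exprn_ge0 ?n0.
rewrite mulr_suml; apply: ler_sum => l _; rewrite normrM.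
by rewrite ler_wpM2l.
Qed.

Lemma normr_pow_mul n (A B : 'M[K]_n.+1) k l i j :
  `|(A ^+ k * B ^+ l) i j| <= mxnorm1 A ^+ k * mxnorm1 B ^+ l.
Proof.
apply: normr_mulmx_pow => {}i {}j.
rewrite -[B ^+ l]mulr1 -[leRHS]mulr1; apply: normr_mulmx_pow => {}i {}j.
by rewrite mxE; case: eqP; rewrite ?normr1 ?normr0 ?ler01.
Qed.

End MatrixLimits.

(** * Complex series and laws of the exponential *)

Section ComplexSeries.
Local Open Scope classical_set_scope.
Variable R : realType.

Lemma normr_ge_Im (z : R[i]) : `|complex.Im z|%:C <= `|z|.
Proof. by rewrite normc_def lecR -sqrtr_sqr ler_wsqrtr // lerDr sqr_ge0. Qed.

Lemma normr_le_ReIm (z : R[i]) : `|z| <= (`|complex.Re z| + `|complex.Im z|)%:C.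
Proof.
rewrite normc_def lecR -[leRHS]ger0_norm ?addr_ge0 // -sqrtr_sqr ler_wsqrtr //.
by rewrite sqrrD !real_normK ?num_real // -addrA lerD2l lerDr mulrn_wge0 // mulr_ge0.
Qed.

Lemma cvg_real_eps (u : nat -> R) l : u @ \oo --> l ->
  forall e, 0 < e -> exists k0 : nat, forall k, (k0 <= k)%N -> `|l - u k| < e.
Proof. by move/(cvg_epsP (K := R)). Qed.

(** In the order of [R[i]] positive elements are real, which turns bounds over [R[i]] into bounds
    over [R]. *)
Lemma complex_gt0 (e : R[i]) : 0 < e -> exists2 r : R, 0 < r & e = r%:C.
Proof.
by case: e => a b; rewrite ltcE /= => /andP[/eqP -> a0]; exists a.
Qed.

Lemma complex_ge0 (e : R[i]) : 0 <= e -> exists2 r : R, 0 <= r & e = r%:C.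
Proof.
by case: e => a b; rewrite lecE /= => /andP[/eqP -> a0]; exists a.
Qed.

Lemma sum_complex (z : nat -> R[i]) k :
  \sum_(0 <= i < k) z i =
  (\sum_(0 <= i < k) complex.Re (z i)) +i* (\sum_(0 <= i < k) complex.Im (z i)).
Proof.
elim: k => [|k IHk]; first by rewrite !big_geq.
by rewrite !big_nat_recr //= IHk; case: (z k).
Qed.

(** Comparison test, applied to the real and to the imaginary parts, both dominated by [v]. *)
Lemma cvg_complex_series (z : nat -> R[i]) (v : nat -> R) :
  (forall k, `|z k| <= (v k)%:C) -> cvgn (series v) ->
  exists l : R[i], forall e, 0 < e -> exists k0 : nat, forall k, (k0 <= k)%N ->
    `|l - \sum_(0 <= i < k) z i| < e.
Proof.
move=> zv cv.
have v0 k : 0 <= v k.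
  by rewrite -lecR; apply: le_trans (zv k); apply: (normr_ge0 (z k)).
have cvg_part (p : R[i] -> R) : (forall w, `|p w|%:C <= `|w|) ->
    exists l : R, series (p \o z) @ \oo --> l.
  move=> pw; apply/cvg_ex/(@normed_cvg _ R^o).
  apply: series_le_cvg cv => // k; first by rewrite /=.
  by rewrite -lecR (le_trans (pw _)).
have [x cx] := cvg_part _ (@normc_ge_Re R).
have [y cy] := cvg_part _ normr_ge_Im.
exists (x +i* y) => _ /complex_gt0[e e0 ->].
have e20 : 0 < e / 2 by rewrite divr_gt0.
have [k1 h1] := cvg_real_eps cx e20.
have [k2 h2] := cvg_real_eps cy e20.
exists (maxn k1 k2) => k; rewrite geq_max => /andP[/h1 {}h1 /h2 {}h2].
apply: le_lt_trans (normr_le_ReIm _) _.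
by rewrite ltcR sum_complex /= [e]splitr ltrD.
Qed.

Lemma series_exp_coeffE k (x : R) : series (exp_coeff x) k = expsum k (x : R^o).
Proof.
rewrite /series /expsum /=; apply: eq_bigr => i _.
by rewrite /exp_coeff /= mulrC.
Qed.

Lemma expsum_cvg n (A : 'M[R[i]]_n.+1) : cvgmx (fun k => expsum k A) (expmx A).
Proof.
have n0 : 0 <= mxnorm1 A by apply: sumr_ge0 => i _; apply: sumr_ge0.
have [a a0 ea] := complex_ge0 n0.
have entry i j : exists l : R[i], (fun k => expsum k A i j) @ \oo --> (l : (R[i] : numFieldType)).
  have := @cvg_complex_series (fun k => ((k`!%:R)^-1 *: A ^+ k) i j) (exp_coeff a).
  case=> [k||l hl].
  - rewrite mxE normrM /exp_coeff /= mulrC rmorphM /= rmorphXn /= fmorphV /= rmorph_nat.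
    rewrite normfV normr_nat ler_wpM2r ?invr_ge0 //.
    have := normr_pow_mul A A k 0 i j.
    by rewrite !expr0 !mulr1 ea.
  - exact: is_cvg_series_exp_coeff.
  exists l; apply/cvg_epsP => e /hl[k0 hk0]; exists k0 => k /hk0.
  by rewrite /expsum summxE.
pose L : 'M[R[i]]_n.+1 := \matrix_(i, j) sval (cid (entry i j)).
have cL : cvgmx (fun k => expsum k A) L.
  by move=> i j; rewrite mxE; exact: (svalP (cid (entry i j))).
by suff -> : expmx A = L by []; exact: (cvgmx_lim cL).
Qed.

(** The relation passes to powers, partial sums and the limit. It serves both to commute [S] with
    [E] and to move [T] across powers of [E]. *)
Lemma expmx_intertwine n (A B X : 'M[R[i]]_n.+1) :
  A *m X = X *m B -> expmx A *m X = X *m expmx B.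
Proof.
move=> AX; have AXk k : A ^+ k *m X = X *m B ^+ k.
  elim: k => [|k IHk]; first by rewrite !expr0 mul1mx mulmx1.
  by rewrite !exprSr -!mulmxE -mulmxA AX !mulmxA IHk.
have := cvgmx_mulmx (@cvgmx_cst R[i] _ _ X) (@expsum_cvg _ B).
rewrite (_ : (fun k => X *m expsum k B) = (fun k => expsum k A *m X)); last first.
  apply/funext => k; rewrite mulmx_sumr mulmx_suml; apply: eq_bigr => i _.
  by rewrite -scalemxAr -scalemxAl AXk.
by apply: cvgmx_unique; apply: cvgmx_mulmx (@cvgmx_cst R[i] _ _ X); exact: expsum_cvg.
Qed.

(** By [expsumD], the defect of the partial sums is bounded entrywise by the same defect [r] for the
    real numbers [a] and [b], the norms of [A] and [B]; and [r] tends to 0 by the functional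
    equation of the real exponential. *)
Lemma expmxD n (A B : 'M[R[i]]_n.+1) : GRing.comm A B ->
  expmx (A + B) = expmx A *m expmx B.
Proof.
move=> cAB.
have n0 (M : 'M[R[i]]_n.+1) : 0 <= mxnorm1 M by apply: sumr_ge0 => i _; apply: sumr_ge0.
have [a a0 ea] := complex_ge0 (n0 A); have [b b0 eb] := complex_ge0 (n0 B).
have cexp x : series (@exp_coeff R x) @ \oo --> expR x by exact: is_cvg_series_exp_coeff.
pose r k := series (exp_coeff a) k * series (exp_coeff b) k - series (exp_coeff (a + b)) k.
have r0 : r @ \oo --> (0 : R).
  rewrite -(subrr (expR (a + b))) {1}expRD.
  by apply: cvgB; [apply: cvgM|]; exact: cexp.
have bound k i j : `|(expsum k A *m expsum k B - expsum k (A + B)) i j| <= (r k)%:C.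
  rewrite expsumD // /r !series_exp_coeffE expsumD; last exact: mulrC.
  rewrite summxE rmorph_sum (le_trans (ler_norm_sum _ _ _)) //.
  apply: ler_sum => l _; rewrite summxE rmorph_sum (le_trans (ler_norm_sum _ _ _)) //.
  apply: ler_sum => m _; rewrite mxE normrM.
  rewrite [X in _ <= X%:C](_ : _ = (l`!%:R)^-1 * (m`!%:R)^-1 * (a ^+ l * b ^+ m)) //.
  rewrite 3!rmorphM /= !rmorphXn /= !fmorphV /= !rmorph_nat -ea -eb.
  by rewrite normrM !normfV !normr_nat ler_wpM2l ?normr_pow_mul // mulr_ge0 ?invr_ge0.
have cAB0 := cvgmx_mulmx (@expsum_cvg _ A) (@expsum_cvg _ B).
apply: cvgmx_unique (@expsum_cvg _ _) _ => i j.
apply/cvg_epsP => e e0.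
have e20 : 0 < e / 2 by rewrite divr_gt0.
have [k1 h1] := (cvg_epsP _ _).1 (cAB0 i j) _ e20.
have [e' e'0 ee'] := complex_gt0 e20.
have [k2 h2] := cvg_real_eps r0 e'0.
exists (maxn k1 k2) => k; rewrite geq_max => /andP[/h1 {}h1 /h2 {}h2].
rewrite -(subrK ((expsum k A *m expsum k B) i j) (_ i j)) -addrA.
apply: le_lt_trans (ler_normD _ _) _; rewrite [e]splitr ltrD //.
have := bound k i j; rewrite !mxE => /le_lt_trans; apply.
rewrite ee' ltcR; apply: le_lt_trans h2; rewrite sub0r normrN.
exact: ler_norm.
Qed.

Lemma expmx0 n : expmx (0 : 'M[R[i]]_n.+1) = 1%:M.
Proof.
apply: cvgmx_unique (@expsum_cvg _ 0) _ => i j; apply/cvg_epsP => e e0.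
exists 1%N => -[//|k] _.
rewrite /expsum big_nat_recl // big1 => [|l _]; last by rewrite exprS mul0r scaler0.
by rewrite fact0 invr1 scale1r expr0 addr0 subrr normr0.
Qed.

Lemma expmx_unit n (A : 'M[R[i]]_n.+1) : expmx A \in unitmx.
Proof.
have := expmxD (commrN (commr_refl A)); rewrite subrr expmx0 => /esym.
by move=> e; have [uA _] := mulmx1_unit e.
Qed.

Lemma expmxzE n (A : 'M[R[i]]_n.+1) (k : int) : expmxz A k = expmx A ^ k.
Proof.
have cz (l m : int) : GRing.comm (l%:~R *: A) (m%:~R *: A).
  by rewrite /GRing.comm -!mulmxE -!scalemxAl -!scalemxAr !scalerA mulrC.
have D (l m : int) : expmxz A (l + m) = expmxz A l *m expmxz A m.
  by rewrite /expmxz intrD scalerDl expmxD.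
have z0 : expmxz A 0 = 1 by rewrite /expmxz scale0r expmx0.
have z1 : expmxz A 1 = expmx A by rewrite /expmxz scale1r.
elim/int_rec: k => [|k IHk|k IHk]; first by rewrite z0 expr0z.
  by rewrite exprSz intS D z1 IHk.
have uA := expmx_unit A.
have kE : 1 + (- k.+1%:Z) = - k%:Z by lia.
have := D 1 (- k.+1%:Z); have := exprzDr uA 1 (- k.+1%:Z).
rewrite kE IHk z1 expr1z => -> /(congr1 (mulmx (invmx (expmx A)))).
by rewrite -mulmxE !mulKmx.
Qed.

End ComplexSeries.

(** * The discrete sine-Gordon equation *)

Section SineGordonField.
Variables (K : fieldType) (f G : int -> int -> K) (e : K).
Hypotheses (f0 : forall k l, f k l != 0) (e0 : e != 0).
Let u k l := e^-1 * G k l / f k l.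
Let w k l := f (k + 1) l * f k (l + 1) / (f k l * f (k + 1) (l + 1)).

(** [G] stands for eps g. The difference of the two sides is that of the bilinear equation divided
    by [e * f k l * f (k + 1) (l + 1)]. *)
Lemma sine_gordon_first d k l :
  (4 - d) * (G k l * f (k + 1) (l + 1) + G (k + 1) (l + 1) * f k l) =
  (4 + d) * (G (k + 1) l * f k (l + 1) + G k (l + 1) * f (k + 1) l) ->
  4 * (u k l + u (k + 1) (l + 1) - (u (k + 1) l + u k (l + 1)) * w k l) =
  d * (u k l + u (k + 1) (l + 1) + (u (k + 1) l + u k (l + 1)) * w k l).
Proof.
move=> bil; apply/eqP; rewrite -subr_eq0; apply/eqP.
rewrite /u /w; move: (f0 k l) (f0 (k + 1) l) (f0 k (l + 1)) (f0 (k + 1) (l + 1)) bil.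
move: (f k l) (f (k + 1) l) (f k (l + 1)) (f (k + 1) (l + 1)) => f00 f10 f01 f11.
move: (G k l) (G (k + 1) l) (G k (l + 1)) (G (k + 1) (l + 1)) => g00 g10 g01 g11.
move=> n00 n10 n01 n11 bil.
transitivity (((4 - d) * (g00 * f11 + g11 * f00) - (4 + d) * (g10 * f01 + g01 * f10))
              / (e * f00 * f11)); first by field; rewrite e0 n00 n01 n10 n11.
by rewrite bil subrr mul0r.
Qed.

Lemma sine_gordon_second (H : int -> int -> K) (eta c : K) (sigma : int) k l :
  (forall k l, G k l * H k l + f k l ^+ 2 = f (k + 1) l * f (k - 1) l) ->
  (forall k l, f (sigma * k) (sigma * l) = c * f k l /\
               eta * G (sigma * k) (sigma * l) = c * H k l) ->
  (1 + eta * e ^+ 2 * u k (l + 1) * u (sigma * k) (sigma * (l + 1))) * w k l =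
  (1 + eta * e ^+ 2 * u k l * u (sigma * k) (sigma * l)) * w (k - 1) l.
Proof.
move=> bil refl.
have c0 : c != 0.
  by apply: contraNneq (f0 (sigma * 0) (sigma * 0)) => c0; rewrite (refl 0 0).1 c0 mul0r.
(* The reflection replaces [eta * G] at the reflected point by [c * H], and [c] cancels against the
   one from [f]. *)
have key i j : 1 + eta * e ^+ 2 * u i j * u (sigma * i) (sigma * j) =
    f (i + 1) j * f (i - 1) j / f i j ^+ 2.
  rewrite -bil /u (refl i j).1.
  transitivity (1 + G i j * (eta * G (sigma * i) (sigma * j)) / (c * f i j ^+ 2)).
    by field; rewrite e0 c0 f0.
  by rewrite (refl i j).2; field; rewrite c0 f0.
(* Both sides equal [f (k + 1) l * f (k - 1) (l + 1) / (f k l * f k (l + 1))]. *)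
rewrite !key /w subrK; move: (f0 k l) (f0 (k + 1) (l + 1)) (f0 k (l + 1)) (f0 (k - 1) l).
move: (f k l) (f (k + 1) l) (f k (l + 1)) (f (k + 1) (l + 1)) (f (k - 1) l) (f (k - 1) (l + 1)).
by move=> x1 x2 x3 x4 x5 x6 n1 n4 n3 n5; field; rewrite n1 n3 n4 n5.
Qed.

End SineGordonField.

Theorem theorem2 (R : realType) (eta sigma : int) (N : nat) (delta epsilon : R)
    (Gamma T S : 'M[R[i]]_((2 * N).+2)) (Cplus Cminus : 'cV[R[i]]_((2 * N).+2))
    (heta : eta = 1 \/ eta = -1)
    (hsigma : sigma = 1 \/ sigma = -1)
    (hepsilon : epsilon != 0)
    (hGT : Gamma *m T + sigma%:~R *: (T *m Gamma) = 0)
    (hT2 : T *m T = (if sigma == 1 then - eta%:~R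
                     else eta%:~R * \det (expmx Gamma) ^+ 2)%:M)
    (hCminus : Cminus = T *m Cplus)
    (hcoth : expmxz Gamma 2 - 1%:M \in unitmx)
    (hplus : 4%:M + (delta * epsilon)%:C *: cothmx Gamma \in unitmx)
    (hminus : 4%:M - (delta * epsilon)%:C *: cothmx Gamma \in unitmx)
    (hS : S *m S = (4%:M + (delta * epsilon)%:C *: cothmx Gamma)
                   *m invmx (4%:M - (delta * epsilon)%:C *: cothmx Gamma))
    (hSpoly : exists p : {poly R[i]}, S = horner_mx Gamma p)
    (hPsi : forall n m : int,
       Psi Gamma S Cminus n m = T *m Phi Gamma S Cplus (sigma * n) (sigma * m)) :
  let f (n m : int) : R[i] :=
    double_casoratian Gamma N.+1 (Phi Gamma S Cplus n m) (Psi Gamma S Cminus n m) in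
  let g (n m : int) : R[i] :=
    (epsilon%:C)^-1 *
    double_casoratian Gamma N.+2 (Phi Gamma S Cplus n m) (Psi Gamma S Cminus n m) in
  let u (n m : int) : R[i] := g n m / f n m in
  let w (n m : int) : R[i] :=
    (f (n + 1) m * f n (m + 1)) / (f n m * f (n + 1) (m + 1)) in
  (forall n m : int, f n m != 0) ->
  solves_discrete_sine_gordon eta sigma delta epsilon u w.
Proof.
move=> f g u w f0.
pose E := expmx Gamma; pose d := (delta * epsilon)%:C.
have uE : E \in unitmx by apply: expmx_unit.
have uS : S \in unitmx.
  have : S *m S \in unitmx by rewrite hS unitmx_mul hplus unitmx_inv.
  by rewrite unitmx_mul => /andP[].
have cSE : GRing.comm S E.
  case: hSpoly => p Sp; apply/esym/expmx_intertwine.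
  by rewrite Sp; apply/comm_mx_horner.
have E2 : expmxz Gamma 2 = E ^ 2 by rewrite expmxzE.
pose D := (4 + - d) *: E ^ 2 - (4 + d)%:M.
(* Multiplication by [e^{2 Gamma} - 1] clears the denominator of coth; used at [x = d] and at
   [x = - d]. *)
have cothD (x : R[i]) : (4%:M + x *: cothmx Gamma) *m (expmxz Gamma 2 - 1%:M) =
    (4 + x) *: E ^ 2 - (4 - x)%:M.
  rewrite mulmxDl -scalemxAl /cothmx mulmxKV // E2 mul_scalar_mx.
  move: (E ^ 2) => M; apply/matrixP => i j; rewrite !mxE.
  by move: (M i j) => y; case: (i == j); rewrite ?mulr1n ?mulr0n; ring.
have DE : D = (4%:M - d *: cothmx Gamma) *m (expmxz Gamma 2 - 1%:M).
  by rewrite -scaleNr cothD opprK.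
have uD : D \in unitmx by rewrite DE unitmx_mul hminus.
have SSD : S * S * D = (4 + d) *: E ^ 2 - (4 - d)%:M.
  by rewrite -cothD DE -!mulmxE hS mulmxA mulmxKV.
have PhiE k l : Phi Gamma S Cplus k l = phi E S Cplus k l by rewrite /Phi expmxzE.
have PsiE k l : Psi Gamma S Cminus k l = psi E S Cminus k l by rewrite /Psi expmxzE.
have casoE p x y : double_casoratian Gamma p x y = cas E p (- N%:Z) N x y.
  congr (\det _); apply/matrixP => i j; rewrite !mxE /=.
  by case: ltnP => _; rewrite expmxzE.
have fE k l : f k l = soliton_cas E S Cplus Cminus N.+1 k l by rewrite /f casoE PhiE PsiE.
pose G := soliton_cas E S Cplus Cminus N.+2.
have uE' k l : u k l = (epsilon%:C)^-1 * G k l / f k l.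
  by rewrite /u /g casoE PhiE PsiE.
have e0 : epsilon%:C != 0 :> R[i] by rewrite -(rmorph0 (real_complex R)) (inj_eq (@complexI _)).
have psiE k l : psi E S Cminus k l = T *m phi E S Cplus (sigma * k) (sigma * l).
  by rewrite -PsiE -PhiE hPsi.
have eta2 : (eta%:~R : R[i]) ^+ 2 = 1 by case: heta => ->; rewrite ?sqrrN expr1n.
have sT : sigma = 1 /\ T *m T = (- eta%:~R)%:M \/
    sigma = -1 /\ T *m T = (eta%:~R * \det E ^+ 2)%:M.
  by case: hsigma => s1; [left|right]; split=> //; rewrite hT2 s1.
(* Since [Gamma T = - sigma T Gamma], [T] intertwines [z Gamma] with [- sigma z Gamma], hence also
   their exponentials. *)
have ET (z : int) : E ^ z *m T = T *m E ^ (- sigma * z).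
  rewrite -!expmxzE; apply: expmx_intertwine.
  have /eqP := hGT; rewrite addr_eq0 => /eqP GT.
  rewrite -scalemxAl GT -scalemxAr scalerN scalerA -scaleNr -intrM -intrN.
  by congr (_%:~R *: _); lia.
have [c refl] := soliton_cas_reflect uE eta2 sT ET psiE.
move=> k l; split.
  rewrite !uE'; apply: (sine_gordon_first f0 e0).
  by rewrite !fE; exact: (soliton_cas_bilinear_m _ _ uE uS cSE uD SSD).
pose H := soliton_cas E S Cplus Cminus N.
rewrite rmorphXn !uE'; apply: (sine_gordon_second f0 e0 (H := H)) => i j.
  by rewrite !fE; exact: (soliton_cas_bilinear_n _ _ _ uE).
by rewrite !fE; exact: refl.
Qed.
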